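(* Up to isomorphism there are exactly 13 extended associative semigroups (EAS) $(\Omega,\rightarrow,\triangleright)$ of cardinality two. More precisely, every EAS of cardinality two is isomorphic to exactly one of the following thirteen EAS on $\Omega=\{X,Y\}$, where the pair of operations is given by the pair of matrices \[\begin{pmatrix} X\rightarrow X & X\rightarrow Y \\ Y\rightarrow X & Y\rightarrow Y \end{pmatrix},\qquad\begin{pmatrix} X\triangleright X & X\triangleright Y \\ Y\triangleright X & Y\triangleright Y \end{pmatrix}:\] A1: $\begin{pmatrix} X & X \\ X & X \end{pmatrix},\begin{pmatrix} X & X \\ X & X \end{pmatrix}$; A2: $\begin{pmatrix} X & X \\ X & X \end{pmatrix},\begin{pmatrix} X & X \\ Y & Y \end{pmatrix}$; C1: $\begin{pmatrix} X & X \\ X & Y \end{pmatrix},\begin{pmatrix} X & X \\ X & X \end{pmatrix}$; C3: $\begin{pmatrix} X & X \\ X & Y \end{pmatrix},\begin{pmatrix} X & X \\ Y & Y \end{pmatrix}$; C5: $\begin{pmatrix} X & X \\ X & Y \end{pmatrix},\begin{pmatrix} Y & Y \\ Y & Y \end{pmatrix}$; C6: $\begin{pmatrix} X & X \\ X & Y \end{pmatrix},\begin{pmatrix} X & X \\ Y & X \end{pmatrix}$; E1'–E2': $\begin{pmatrix} X & X \\ Y & Y \end{pmatrix},\begin{pmatrix} X & X \\ X & X \end{pmatrix}$; E3': $\begin{pmatrix} X & X \\ Y & Y \end{pmatrix},\begin{pmatrix} X & X \\ Y & Y \end{pmatrix}$; F1: $\begin{pmatrix} X & Y \\ X & Y \end{pmatrix},\begin{pmatrix}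 X & X \\ X & X \end{pmatrix}$; F3: $\begin{pmatrix} X & Y \\ X & Y \end{pmatrix},\begin{pmatrix} X & X \\ Y & Y \end{pmatrix}$; F4: $\begin{pmatrix} X & Y \\ X & Y \end{pmatrix},\begin{pmatrix} X & Y \\ Y & X \end{pmatrix}$; H1: $\begin{pmatrix} X & Y \\ Y & X \end{pmatrix},\begin{pmatrix} X & X \\ X & X \end{pmatrix}$; H2: $\begin{pmatrix} X & Y \\ Y & X \end{pmatrix},\begin{pmatrix} X & X \\ Y & Y \end{pmatrix}$. Among them, the CEDS are A1, A2, C1, C3, C5, F1, F3, F4, H1, H2; the dual CEDS are A1, A2, C3, E3', F1, F3, F4, H2; the non-degenerate ones are F3, F4, H2.
   Context: An extended associative semigroup (EAS) is a triple $(\Omega,\rightarrow,\triangleright)$, where $\Omega$ is a nonempty set and $\rightarrow,\triangleright\colon\Omega^2\to\Omega$ are maps such that for all $\alpha,\beta,\gamma\in\Omega$: $\alpha\rightarrow(\beta\rightarrow\gamma)=(\alpha\rightarrow\beta)\rightarrow\gamma$; $(\alpha\triangleright(\beta\rightarrow\gamma))\rightarrow(\beta\triangleright\gamma)=(\alpha\rightarrow\beta)\triangleright\gamma$; $(\alpha\triangleright(\beta\rightarrow\gamma))\triangleright(\beta\triangleright\gamma)=\alpha\triangleright\beta$. An isomorphism of EAS is a bijection compatible with both operations. An EAS is a CEDS if moreover $(\alpha\rightarrow\beta)\rightarrow\gamma=(\beta\rightarrow\alpha)\rightarrow\gamma$ and $\alpha\triangleright(\beta\rightarrow\gamma)=\alpha\triangleright\gamma$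 for all $\alpha,\beta,\gamma$. An EAS is a dual CEDS if moreover $(\alpha\triangleright\beta)\rightarrow\gamma=\alpha\rightarrow\gamma$ and $(\alpha\triangleright\beta)\triangleright\gamma=(\alpha\triangleright\gamma)\triangleright\beta$ for all $\alpha,\beta,\gamma$. An EAS is non-degenerate if the map $(\alpha,\beta)\mapsto(\alpha\rightarrow\beta,\alpha\triangleright\beta)$ from $\Omega^2$ to $\Omega^2$ is bijective. *)

(* Defs.v *)
From HB Require Import structures.
From mathcomp Require Import all_boot.

Set Implicit Arguments.
Unset Strict Implicit.
Unset Printing Implicit Defensive.

(* A set with two binary operations; the axioms of an EAS are the separate
   predicate [is_EAS]. *)
Record eas_data := EasData {
  carrier :> Type;
  arr : carrier -> carrier -> carrier;
  tri : carrier -> carrier -> carrier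
}.

Declare Scope eas_scope.
Delimit Scope eas_scope with eas.
Notation "a ->> b" := (arr a b)
  (at level 50, left associativity) : eas_scope.
Notation "a |> b" := (tri a b)
  (at level 50, left associativity) : eas_scope.
Local Open Scope eas_scope.

Definition is_EAS (S : eas_data) : Prop :=
  [/\ inhabited S,
      forall a b c : S, a ->> (b ->> c) = (a ->> b) ->> c,
      forall a b c : S, (a |> (b ->> c)) ->> (b |> c) = (a ->> b) |> c
    & forall a b c : S, (a |> (b ->> c)) |> (b |> c) = a |> b].

Definition is_CEDS (S : eas_data) : Prop :=
  [/\ is_EAS S,
      forall a b c : S, (a ->> b) ->> c = (b ->> a) ->> c
    & forall a b c : S, a |> (b ->> c) = a |> c].

Definition is_dual_CEDS (S : eas_data) : Prop :=
  [/\ is_EAS S,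
      forall a b c : S, (a |> b) ->> c = a ->> c
    & forall a b c : S, (a |> b) |> c = (a |> c) |> b].

Definition is_nondegenerate_EAS (S : eas_data) : Prop :=
  is_EAS S /\ bijective (fun p : S * S => (p.1 ->> p.2, p.1 |> p.2)).

Definition isomorphic (S T : eas_data) : Prop :=
  exists f : S -> T,
    [/\ bijective f,
        forall a b : S, f (a ->> b) = f a ->> f b
      & forall a b : S, f (a |> b) = f a |> f b].

Definition has_card (T : Type) (n : nat) : Prop :=
  exists f : T -> 'I_n, bijective f.

(* [F] is an irredundant and complete list of the EAS of cardinality [n] up to
   isomorphism. *)
Definition classifies_EAS_of_card (n : nat) (I : Type) (F : I -> eas_data) :
    Prop :=
  [/\ forall i, is_EAS (F i) /\ has_card (F i) n,
      forall i j, isomorphic (F i) (F j) -> i = j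
    & forall S : eas_data, is_EAS S -> has_card S n ->
        exists! i, isomorphic S (F i)].

Inductive XY : Set := X | Y.

(* The operation with matrix (xx xy; yx yy): the row is the left argument and
   the column is the right argument. *)
Definition op_of_matrix (xx xy yx yy : XY) (a b : XY) : XY :=
  match a, b with
  | X, X => xx
  | X, Y => xy
  | Y, X => yx
  | Y, Y => yy
  end.

(* [E12'] is the EAS called E1'-E2'. *)
Inductive label : Set :=
  A1 | A2 | C1 | C3 | C5 | C6 | E12' | E3' | F1 | F3 | F4 | H1 | H2.

Scheme Boolean Equality for label.

Lemma label_eqP : Equality.axiom label_beq.
Proof. by do 2!case; constructor. Qed.

HB.instance Definition _ := hasDecEq.Build label label_eqP.

Definition EAS2 (l : label) : eas_data :=
  match l with
  | A1   => EasData (op_of_matrix X X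
                                  X X) (op_of_matrix X X
                                                     X X)
  | A2   => EasData (op_of_matrix X X
                                  X X) (op_of_matrix X X
                                                     Y Y)
  | C1   => EasData (op_of_matrix X X
                                  X Y) (op_of_matrix X X
                                                     X X)
  | C3   => EasData (op_of_matrix X X
                                  X Y) (op_of_matrix X X
                                                     Y Y)
  | C5   => EasData (op_of_matrix X X
                                  X Y) (op_of_matrix Y Y
                                                     Y Y)
  | C6   => EasData (op_of_matrix X X
                                  X Y) (op_of_matrix X X
                                                     Y X)
  | E12' => EasData (op_of_matrix X X
                                  Y Y) (op_of_matrix X X
                                                     X X)
  | E3'  => EasData (op_of_matrix X X
                                  Y Y) (op_of_matrix X X
                                                     Y Y)
  | F1   => EasData (op_of_matrix X Y
                                  X Y) (op_of_matrix X X
                                                     X X)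
  | F3   => EasData (op_of_matrix X Y
                                  X Y) (op_of_matrix X X
                                                     Y Y)
  | F4   => EasData (op_of_matrix X Y
                                  X Y) (op_of_matrix X Y
                                                     Y X)
  | H1   => EasData (op_of_matrix X Y
                                  Y X) (op_of_matrix X X
                                                     X X)
  | H2   => EasData (op_of_matrix X Y
                                  Y X) (op_of_matrix X X
                                                     Y Y)
  end.

(* Main.v *)
From HB Require Import structures.
Require Import Defs.
From mathcomp Require Import all_boot.

(** Every notion in the theorem is invariant under isomorphism or refers to a
    structure carried by [XY], and on the two-point set [XY] every quantifier
    is a finite conjunction.  The axioms of EAS, CEDS and dual CEDS thus become
    boolean tests on the two operation tables ([EASP], [CEDSP], [dual_CEDSP]).
    Non-degeneracy becomes the injectivity of a self-map of the finite set
    [XY * XY] ([nondegP]), and since the only bijections of [XY] are the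
    identity and the transposition, isomorphism is also a boolean test
    ([isoP]).

    An EAS of cardinality two can be transported to [XY] along any bijection
    ([transport_XY]), where it is one of the 2^4 * 2^4 = 256 pairs of tables.
    Running through all of them shows that each pair that satisfies the axioms
    is carried, by the identity or by the transposition, to a pair of the list
    ([EAS_on_XY]); running through the 13 * 13 pairs of labels shows that no
    two entries of the list are isomorphic ([EAS2_irredundant]).  Uniqueness of
    the label of a given EAS then follows because isomorphism is an equivalence
    relation, and the count 13 is the number of labels. *)

Set Implicit Arguments.
Unset Strict Implicit.
Unset Printing Implicit Defensive.

Local Open Scope eas_scope.

(** * Isomorphism of EAS data *)

Lemma isomorphic_sym S T : isomorphic S T -> isomorphic T S.
Proof.
case=> f [[g fK gK] f_arr f_tri]; exists g; split=> [|a b|a b].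
- by exists f.
- by rewrite -{1}(gK a) -{1}(gK b) -f_arr fK.
- by rewrite -{1}(gK a) -{1}(gK b) -f_tri fK.
Qed.

Lemma isomorphic_trans S T U :
  isomorphic S T -> isomorphic T U -> isomorphic S U.
Proof.
case=> f [f_bij f_arr f_tri] [g [g_bij g_arr g_tri]].
exists (g \o f); split=> [|a b|a b] /=.
- exact: bij_comp.
- by rewrite f_arr g_arr.
- by rewrite f_tri g_tri.
Qed.

Lemma isomorphic_EAS S T : isomorphic S T -> is_EAS S -> is_EAS T.
Proof.
case=> f [[g fK gK] f_arr f_tri] [[s] ax1 ax2 ax3].
split=> [|a b c|a b c|a b c].
- exact: (inhabits (f s)).
- by rewrite -(gK a) -(gK b) -(gK c) -!f_arr ax1.
- by rewrite -(gK a) -(gK b) -(gK c) -!(f_arr, f_tri) ax2.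
- by rewrite -(gK a) -(gK b) -(gK c) -!(f_arr, f_tri) ax3.
Qed.

Lemma classifies_reindex n (I J : Type) (e : J -> I) (F : I -> eas_data) :
  bijective e -> classifies_EAS_of_card n F ->
  classifies_EAS_of_card n (F \o e).
Proof.
move=> [d eK dK] [F_EAS F_inj F_full]; split=> [j|i j /F_inj|S S_EAS S_n] /=.
- exact: F_EAS.
- exact: (can_inj eK).
- have [i [Si i_uniq]] := F_full S S_EAS S_n.
  exists (d i); split=> [|j /i_uniq ->]; last exact: eK.
  by rewrite dK.
Qed.

(** * The two-point set *)

Definition bool_of_XY (a : XY) : bool := if a is X then true else false.
Definition XY_of_bool (b : bool) : XY := if b then X else Y.

Lemma bool_of_XYK : cancel bool_of_XY XY_of_bool.
Proof. by case. Qed.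

Lemma XY_of_boolK : cancel XY_of_bool bool_of_XY.
Proof. by case. Qed.

HB.instance Definition _ := Finite.copy XY (can_type bool_of_XYK).

Lemma card_XY : #|{: XY}| = 2.
Proof.
rewrite -card_bool; apply: bij_eq_card; exists XY_of_bool.
  exact: bool_of_XYK.
exact: XY_of_boolK.
Qed.

Lemma has_card_XY : has_card XY 2.
Proof. by rewrite -card_XY; exists enum_rank; apply: enum_rank_bij. Qed.

Lemma XY_of_card2 T : has_card T 2 -> exists f : T -> XY, bijective f.
Proof.
case=> f f_bij; have [g g_bij] := has_card_XY.
have [h gK hK] := g_bij.
by exists (h \o f); apply: bij_comp f_bij; exists g.
Qed.

Notation opXY := (XY -> XY -> XY).

(** The library quantifier [forall x, P] over a finite type is locked and does
    not reduce; these conjunctions do. *)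
Definition all_XY (P : pred XY) : bool := P X && P Y.
Definition all2_XY (P : XY -> XY -> bool) : bool :=
  all_XY (fun a => all_XY (P a)).
Definition all3_XY (P : XY -> XY -> XY -> bool) : bool :=
  all_XY (fun a => all2_XY (P a)).

Lemma all_XYP (P : pred XY) : reflect (forall a, P a) (all_XY P).
Proof. by apply: (iffP andP) => [[PX PY] []|allP]. Qed.

Lemma all2_XYP (P : XY -> XY -> bool) :
  reflect (forall a b, P a b) (all2_XY P).
Proof.
by apply: (iffP (all_XYP _)) => allP a; [apply/all_XYP|apply/all_XYP/allP].
Qed.

Lemma all3_XYP (P : XY -> XY -> XY -> bool) :
  reflect (forall a b c, P a b c) (all3_XY P).
Proof.
by apply: (iffP (all_XYP _)) => allP a; [apply/all2_XYP|apply/all2_XYP/allP].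
Qed.

Lemma eq3_XYP (l r : XY -> XY -> XY -> XY) :
  reflect (forall a b c, l a b c = r a b c)
          (all3_XY (fun a b c => l a b c == r a b c)).
Proof. by apply: (iffP (all3_XYP _)) => eq_lr a b c; apply/eqP. Qed.

Lemma eq2_XYP (l r : opXY) :
  reflect (forall a b, l a b = r a b) (all2_XY (fun a b => l a b == r a b)).
Proof. by apply: (iffP (all2_XYP _)) => eq_lr a b; apply/eqP. Qed.

(** * Boolean tests on operation tables *)

Definition EASb (p q : opXY) : bool :=
  [&& all3_XY (fun a b c => p a (p b c) == p (p a b) c),
      all3_XY (fun a b c => p (q a (p b c)) (q b c) == q (p a b) c)
    & all3_XY (fun a b c => q (q a (p b c)) (q b c) == q a b)].

Lemma EASP p q : reflect (is_EAS (EasData p q)) (EASb p q).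
Proof.
apply: (iffP and3P) => [[/eq3_XYP ax1 /eq3_XYP ax2 /eq3_XYP ax3]|[_ *]].
  by split=> //; exists; exact: X.
by split; apply/eq3_XYP.
Qed.

Definition CEDSb (p q : opXY) : bool :=
  [&& EASb p q,
      all3_XY (fun a b c => p (p a b) c == p (p b a) c)
    & all3_XY (fun a b c => q a (p b c) == q a c)].

Lemma CEDSP p q : reflect (is_CEDS (EasData p q)) (CEDSb p q).
Proof.
apply: (iffP and3P) => [[/EASP ax1 /eq3_XYP ax2 /eq3_XYP ax3] //|[ax1 *]].
by split; [apply/EASP|apply/eq3_XYP|apply/eq3_XYP].
Qed.

Definition dual_CEDSb (p q : opXY) : bool :=
  [&& EASb p q,
      all3_XY (fun a b c => p (q a b) c == p a c)
    & all3_XY (fun a b c => q (q a b) c == q (q a c) b)].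

Lemma dual_CEDSP p q : reflect (is_dual_CEDS (EasData p q)) (dual_CEDSb p q).
Proof.
apply: (iffP and3P) => [[/EASP ax1 /eq3_XYP ax2 /eq3_XYP ax3] //|[ax1 *]].
by split; [apply/EASP|apply/eq3_XYP|apply/eq3_XYP].
Qed.

Definition nondegb (p q : opXY) : bool :=
  EASb p q &&
  all2_XY (fun a b => all2_XY (fun c d =>
    (p a b == p c d) && (q a b == q c d) ==> (a == c) && (b == d))).

(** Bijectivity is tested as injectivity, the two being equivalent for a
    self-map of a finite set. *)
Lemma nondegP p q :
  reflect (is_nondegenerate_EAS (EasData p q)) (nondegb p q).
Proof.
apply: (iffP andP) => [[/EASP pq_EAS /all2_XYP inj]|[/EASP pq_EAS /bij_inj inj]].
  split=> //; apply: (injF_bij (T := (XY * XY)%type)).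
  move=> [a b] [c d] /= [eq_p eq_q].
  have /all2_XYP/(_ c d)/implyP := inj a b.
  by rewrite eq_p eq_q !eqxx => /(_ isT)/andP[/eqP-> /eqP->].
split=> //; apply/all2_XYP => a b; apply/all2_XYP => c d.
apply/implyP=> /andP[/eqP eq_p /eqP eq_q].
have [-> ->] : (a, b) = (c, d) by apply: inj => /=; rewrite eq_p eq_q.
by rewrite !eqxx.
Qed.

Definition swap_XY (a : XY) : XY := if a is X then Y else X.

Lemma swap_XYK : involutive swap_XY.
Proof. by case. Qed.

Lemma inj_XY (f : XY -> XY) : injective f -> f =1 id \/ f =1 swap_XY.
Proof.
move=> f_inj; have fXY : f X <> f Y by move/f_inj.
case fX: (f X) fXY; case fY: (f Y) => // _.
  by left; case.
by right; case.
Qed.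

Definition morphb (f : XY -> XY) (p q p' q' : opXY) : bool :=
  all2_XY (fun a b => f (p a b) == p' (f a) (f b)) &&
  all2_XY (fun a b => f (q a b) == q' (f a) (f b)).

Lemma eq_morphb f g p q p' q' : f =1 g -> morphb f p q p' q' = morphb g p q p' q'.
Proof. by move=> fg; rewrite /morphb /all2_XY /all_XY !fg. Qed.

Definition isob (p q p' q' : opXY) : bool :=
  morphb id p q p' q' || morphb swap_XY p q p' q'.

Lemma isoP p q p' q' :
  reflect (isomorphic (EasData p q) (EasData p' q')) (isob p q p' q').
Proof.
apply: (iffP orP) => [|[f [/bij_inj f_inj f_arr f_tri]]].
  by case=> /andP[/eq2_XYP f_arr /eq2_XYP f_tri];
     [exists id|exists swap_XY]; split=> //;
     [exists id|apply: inv_bij swap_XYK].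
have f_morph : morphb f p q p' q' by apply/andP; split; apply/eq2_XYP.
by case: (inj_XY f_inj) => /eq_morphb <-; [left|right].
Qed.

(** * The thirteen structures *)

(** The carrier of [EAS2 l] reduces to [XY] only once the label is known, so
    the operations get type [opXY] for a variable label by a case analysis
    whose branches all coincide. *)
Definition to_opXY (l : label) :
    (EAS2 l -> EAS2 l -> EAS2 l) -> opXY :=
  match l with
  | A1 | A2 | C1 | C3 | C5 | C6 | E12' | E3' | F1 | F3 | F4 | H1 | H2 =>
      fun op => op
  end.

Definition arr2 (l : label) : opXY := to_opXY (@arr (EAS2 l)).
Definition tri2 (l : label) : opXY := to_opXY (@tri (EAS2 l)).

Lemma EAS2E l : EAS2 l = EasData (arr2 l) (tri2 l).
Proof. by case: l. Qed.

Definition labels : seq label :=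
  [:: A1; A2; C1; C3; C5; C6; E12'; E3'; F1; F3; F4; H1; H2].

Lemma mem_labels l : l \in labels.
Proof. by case: l. Qed.

Lemma nth_labels_bij : bijective (fun i : 'I_13 => nth A1 labels i).
Proof.
exists (fun l => inord (index l labels)) => [i|l].
  by rewrite index_uniq // inord_val.
by rewrite inordK ?nth_index ?mem_labels // (index_mem l labels) mem_labels.
Qed.

Lemma EAS2_EAS l : is_EAS (EAS2 l).
Proof. by rewrite EAS2E; apply/EASP; case: l. Qed.

Lemma EAS2_card l : has_card (EAS2 l) 2.
Proof. by rewrite EAS2E; apply: has_card_XY. Qed.

Lemma EAS2_irredundant i j : isomorphic (EAS2 i) (EAS2 j) -> i = j.
Proof. by rewrite !EAS2E => /isoP; case: i; case: j. Qed.

Lemma op_of_matrixE (p : opXY) :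
  p =2 op_of_matrix (p X X) (p X Y) (p Y X) (p Y Y).
Proof. by do 2!case. Qed.

Lemma transport_XY (S : eas_data) : has_card S 2 ->
  exists p00 p01 p10 p11 q00 q01 q10 q11,
    isomorphic S (EasData (op_of_matrix p00 p01 p10 p11)
                          (op_of_matrix q00 q01 q10 q11)).
Proof.
case/XY_of_card2=> f [g fK gK].
pose p a b := f (g a ->> g b); pose q a b := f (g a |> g b).
exists (p X X), (p X Y), (p Y X), (p Y Y), (q X X), (q X Y), (q Y X), (q Y Y).
exists f; split=> [|a b|a b]; first by exists g.
  by rewrite /= -op_of_matrixE /p !fK.
by rewrite /= -op_of_matrixE /q !fK.
Qed.

(** The exhaustive search over the 256 pairs of tables. *)
Lemma EAS_on_XY p00 p01 p10 p11 q00 q01 q10 q11 :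
  let p := op_of_matrix p00 p01 p10 p11 in
  let q := op_of_matrix q00 q01 q10 q11 in
  EASb p q -> has (fun l => isob p q (arr2 l) (tri2 l)) labels.
Proof.
by case: p00; case: p01; case: p10; case: p11;
   case: q00; case: q01; case: q10; case: q11.
Qed.

Lemma EAS2_complete (S : eas_data) :
  is_EAS S -> has_card S 2 -> exists l, isomorphic S (EAS2 l).
Proof.
move=> S_EAS /transport_XY[p00 [p01 [p10 [p11 [q00 [q01 [q10 [q11 S_XY]]]]]]]].
have /EASP/EAS_on_XY/hasP[l _ /isoP XY_l] := isomorphic_EAS S_XY S_EAS.
by exists l; rewrite EAS2E; apply: isomorphic_trans S_XY XY_l.
Qed.

Lemma EAS2_classifies : classifies_EAS_of_card 2 EAS2.
Proof.
split=> [l||S S_EAS S_2].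
- by split; [apply: EAS2_EAS|apply: EAS2_card].
- exact: EAS2_irredundant.
have [l Sl] := EAS2_complete S_EAS S_2.
exists l; split=> // k Sk; apply: EAS2_irredundant.
exact: isomorphic_trans (isomorphic_sym Sl) Sk.
Qed.

Theorem mainTheorem3 :
  (exists F : 'I_13 -> eas_data, classifies_EAS_of_card 2 F) /\
  classifies_EAS_of_card 2 EAS2 /\
  (forall l : label, is_CEDS (EAS2 l) <->
     l \in [:: A1; A2; C1; C3; C5; F1; F3; F4; H1; H2]) /\
  (forall l : label, is_dual_CEDS (EAS2 l) <->
     l \in [:: A1; A2; C3; E3'; F1; F3; F4; H2]) /\
  (forall l : label, is_nondegenerate_EAS (EAS2 l) <->
     l \in [:: F3; F4; H2]).
Proof.
split; last split; last split; last split.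
- by eexists; apply: classifies_reindex nth_labels_bij EAS2_classifies.
- exact: EAS2_classifies.
- by move=> l; rewrite EAS2E; apply: (iff_trans (rwP (CEDSP _ _))); case: l.
- by move=> l; rewrite EAS2E; apply: (iff_trans (rwP (dual_CEDSP _ _))); case: l.
- by move=> l; rewrite EAS2E; apply: (iff_trans (rwP (nondegP _ _))); case: l.
Qed.
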